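(* Let $(X,d)$ be a metric space with basepoint $e\in X$. If $(X,d)$ is complete, then the metric completion of $(\mathbb{N}[X],d_{\mathbb{N}[X]})$ is isometric to $(\overline{\mathbb{N}}[X],d_\ell)$. In particular, the canonical embedding $\iota:\mathbb{N}[X]\hookrightarrow\overline{\mathbb{N}}[X]$, $\iota([x_1,\dots,x_m])=[x_1,\dots,x_m,e,e,\dots]$, has dense image, and $\overline{\mathbb{N}}[X]$ is complete.
   Context: Let $(X,d)$ be a metric space with distinguished basepoint $e\in X$. For $n\ge 1$, $\mathrm{SP}^n(X)=X^n/S_n$ is the quotient of $X^n$ by the coordinate-permutation action of the symmetric group $S_n$; the orbit of $(x_1,\dots,x_n)$ is written $[x_1,\dots,x_n]$. The map $[x_1,\dots,x_n]\mapsto[x_1,\dots,x_n,e]$ embeds $\mathrm{SP}^n(X)$ in $\mathrm{SP}^{n+1}(X)$, and the set $\mathrm{SP}(X)$ is the union $\bigcup_{n\ge1}\mathrm{SP}^n(X)$ of the increasing sequence so obtained. Thus elements of $\mathrm{SP}(X)$ are finite unordered lists $[x_1,\dots,x_m]$ of points of $X$, with $[x_1,\dots,x_m]=[x_1,\dots,x_m,e]$. Matching distance: for $[x_1,\dots,x_m],[y_1,\dots,y_n]\in \mathrm{SP}(X)$ and $N\ge m+n$ let $\mathbf{x}_N=(x_1,\dots,x_m,e,\dots,e)$ and $\mathbf{y}_N=(y_1,\dots,y_n,e,\dots,e)$ be the lists padded with copies of $e$ to length $N$, and let $\mathbf{x}_N(i)$, $\mathbf{y}_N(i)$ be their $i$-th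 entries. Then $$d_{\mathbb{N}[X]}([x_1,\dots,x_m],[y_1,\dots,y_n]):=\inf_{N\ge m+n}\ \min_{\sigma\in S_N}\ \sum_{i=1}^N d\bigl(\mathbf{x}_N(i),\mathbf{y}_N(\sigma(i))\bigr),$$ which is a well-defined metric on the set $\mathrm{SP}(X)$. The metric space $(\mathrm{SP}(X),d_{\mathbb{N}[X]})$ is denoted $\mathbb{N}[X]$. $\ell^1$-multisets: let $X^\ast$ be the set of sequences $\mathbf{x}=(x_i)_{i\in\mathbb{N}}$ in $X$ with $\sum_{i=1}^\infty d(x_i,e)<\infty$. For $\mathbf{x},\mathbf{y}\in X^\ast$ set $\tilde d_\ell(\mathbf{x},\mathbf{y}):=\inf_{\sigma\in S_\infty}\sum_{i=1}^\infty d(x_i,y_{\sigma(i)})$, where $S_\infty$ is the group of all bijections of $\mathbb{N}$; this is a pseudometric on $X^\ast$. Write $\mathbf{x}\sim\mathbf{y}$ if $\tilde d_\ell(\mathbf{x},\mathbf{y})=0$. The $\ell^1$-multiset space is $\overline{\mathbb{N}}[X]:=X^\ast/\sim$, with elements denoted $[x_1,x_2,\dots]$, and $d_\ell$ is the metric on $\overline{\mathbb{N}}[X]$ induced by $\tilde d_\ell$. *)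

(* Defs.v *)
From HB Require Import structures.
From mathcomp Require Import all_boot all_order all_algebra all_fingroup.
From mathcomp Require Import generic_quotient.
From mathcomp Require Import all_classical all_reals all_analysis.
From mathcomp Require Import zify lra.

Set Implicit Arguments.
Unset Strict Implicit.
Unset Printing Implicit Defensive.

Import Order.TTheory GRing.Theory Num.Theory.
Import numFieldNormedType.Exports.

Local Open Scope classical_set_scope.
Local Open Scope quotient_scope.
Local Open Scope ring_scope.

Definition distance_preserving (R : realType) (M N : metricType R) (f : M -> N) : Prop :=
  forall x y : M, mdist (f x) (f y) = mdist x y.

(* This is the axiom of the library's [completeType], except that the limit is
   quantified existentially: [cvg F] would need a canonical point in [M]. *)
Definition complete (M : uniformType) : Prop :=
  forall F : set_system M, ProperFilter F -> cauchy F -> exists l : M, F --> l.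

Record pseudometric (R : realType) (T : Type) := Pseudometric {
  pdist :> T -> T -> R ;
  pdistxx : forall x, pdist x x = 0 ;
  pdist_sym : forall x y, pdist x y = pdist y x ;
  pdist_triangle : forall y x z, pdist x z <= pdist x y + pdist y z }.

Section metric_quotient.
Context {R : realType} {T : choiceType} (d : pseudometric R T).

Lemma pdist_ge0 x y : 0 <= d x y.
Proof.
have := pdist_triangle d y x x; rewrite pdistxx (pdist_sym d y x); lra.
Qed.

Definition dist0 : rel T := fun x y => d x y == 0.

Lemma dist0_refl : reflexive dist0.
Proof. by move=> x; rewrite /dist0 pdistxx. Qed.

Lemma dist0_sym : symmetric dist0.
Proof. by move=> x y; rewrite /dist0 pdist_sym. Qed.

Lemma dist0_trans : transitive dist0.
Proof.
move=> y x z /eqP xy /eqP yz; apply/eqP.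
have := pdist_triangle d y x z; have := pdist_ge0 x z.
by rewrite xy yz; lra.
Qed.

Canonical dist0_equiv := EquivRel dist0 dist0_refl dist0_sym dist0_trans.

Definition metric_quotient := {eq_quot dist0}.

HB.instance Definition _ := Choice.on metric_quotient.
HB.instance Definition _ := EqQuotient.on metric_quotient.

Definition qdist (p q : metric_quotient) : R := d (repr p) (repr q).

Lemma dist0_pdist x x' y y' : dist0 x x' -> dist0 y y' -> d x y = d x' y'.
Proof.
move=> /eqP xx' /eqP yy'.
have := pdist_triangle d x' x y; have := pdist_triangle d y' x' y.
have := pdist_triangle d x x' y'; have := pdist_triangle d y x y'.
rewrite (pdist_sym d x' x) (pdist_sym d y' y) xx' yy'.
lra.
Qed.

Lemma dist0_repr x : dist0 (repr (\pi_metric_quotient x)) x.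
Proof. by apply/(@eqmodP _ dist0_equiv); rewrite reprK. Qed.

Lemma qdistE x y :
  qdist (\pi_metric_quotient x) (\pi_metric_quotient y) = d x y.
Proof. exact: dist0_pdist (dist0_repr x) (dist0_repr y). Qed.

Lemma qdistxx p : qdist p p = 0. Proof. exact: pdistxx. Qed.

Lemma qdist_eq0 p q : qdist p q = 0 -> p = q.
Proof.
move=> pq; rewrite -[p]reprK -[q]reprK.
by apply/(@eqmodP _ dist0_equiv)/eqP.
Qed.

Lemma qdist_sym p q : qdist p q = qdist q p. Proof. exact: pdist_sym. Qed.

Lemma qdist_triangle q p r : qdist p r <= qdist p q + qdist q r.
Proof. exact: pdist_triangle. Qed.

HB.instance Definition _ := isMetric.Build R metric_quotient
  qdistxx qdist_eq0 qdist_sym qdist_triangle.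

Lemma mdist_pi x y :
  mdist (\pi_metric_quotient x) (\pi_metric_quotient y) = d x y.
Proof. exact: qdistE. Qed.

End metric_quotient.

Section completion.
Context {R : realType} (M : metricType R).

Definition cauchy_seq : set (nat -> M) := [set u | cauchy (u @ \oo)].

Definition cauchy_dist (u v : cauchy_seq) : R :=
  limn (fun n => mdist (val u n) (val v n)).

Lemma cauchy_seqP (u : nat -> M) : cauchy_seq u ->
  forall eps : R, 0 < eps ->
  exists N, forall m n, (N <= m)%N -> (N <= n)%N -> mdist (u m) (u n) < eps.
Proof.
move=> cu eps e0.
have /cauchy_ballP/(_ eps e0) : cauchy (u @ \oo) by [].
case=> -[/= A B] [[N1 _ HA] [N2 _ HB]] H.
exists (maxn N1 N2) => m n; rewrite !geq_max => /andP[m1 m2] /andP[n1 n2].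
have := H (u m, u n); rewrite ballEmdist/=; apply; split.
  exact: HA.
exact: HB.
Qed.

Lemma cauchy_dist_cvg (u v : cauchy_seq) :
  cvgn (fun n => mdist (val u n) (val v n)).
Proof.
apply/cauchy_cvgP/cauchy_exP => e e0.
have e20 : 0 < e / 2 by rewrite divr_gt0.
have [N1 H1] := cauchy_seqP (set_valP u) e20.
have [N2 H2] := cauchy_seqP (set_valP v) e20.
pose N := maxn N1 N2.
exists (mdist (val u N) (val v N)); exists N => // n /= Nn.
have u1 : (N1 <= N)%N by rewrite leq_maxl.
have v1 : (N2 <= N)%N by rewrite leq_maxr.
have := H1 N n u1 (leq_trans u1 Nn).
have := H2 N n v1 (leq_trans v1 Nn).
have T1 := metric_triangle (val u N) (val u n) (val v N).
have T2 := metric_triangle (val u n) (val v n) (val v N).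
have T3 := metric_triangle (val u n) (val u N) (val v n).
have T4 := metric_triangle (val u N) (val v N) (val v n).
rewrite (metric_sym (val v n)) in T2; rewrite (metric_sym (val u n) (val u N)) in T3.
rewrite /ball/= => ? ?; rewrite ltr_norml; apply/andP; split; lra.
Qed.

Lemma cauchy_distxx u : cauchy_dist u u = 0.
Proof.
rewrite /cauchy_dist; under eq_fun do rewrite mdistxx.
exact: lim_cst.
Qed.

Lemma cauchy_dist_sym u v : cauchy_dist u v = cauchy_dist v u.
Proof. by rewrite /cauchy_dist; under eq_fun do rewrite metric_sym. Qed.

Lemma cauchy_dist_triangle v u w :
  cauchy_dist u w <= cauchy_dist u v + cauchy_dist v w.
Proof.
rewrite /cauchy_dist -limD; [|exact: cauchy_dist_cvg..].
apply: ler_lim; first exact: cauchy_dist_cvg.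
  by apply: is_cvgD; exact: cauchy_dist_cvg.
by apply: nearW => n; exact: metric_triangle.
Qed.

Definition cauchy_pseudometric : pseudometric R cauchy_seq :=
  Pseudometric cauchy_distxx cauchy_dist_sym cauchy_dist_triangle.

Definition completion := metric_quotient cauchy_pseudometric.

HB.instance Definition _ := Metric.on completion.
HB.instance Definition _ := EqQuotient.on completion.

Lemma cst_cauchy_seq (x : M) : cauchy_seq (fun=> x).
Proof.
apply/cauchy_ballP => e e0; exists ([set x], [set x]) => /=.
  by split; exists 0%N => // n _.
by move=> [a b] /= [-> ->]; rewrite ballEmdist/= mdistxx.
Qed.

Definition to_completion (x : M) : completion :=
  \pi_completion (SigSub (mem_set (cst_cauchy_seq x))).

End completion.

Section finite_multisets.
Context {R : realType} {X : metricType R} (e : X).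
Implicit Types x y z : seq X.

(* [nth e x i] is the [i]-th entry of [x] padded with infinitely many [e]'s. *)
Definition padded (N : nat) x : seq X := mkseq (nth e x) N.

(* Two lists are identified when they have the same class in some SP^N(X).
   The empty list, identified with [:: e], is allowed: the quotient is still
   the union of the SP^n(X) for n >= 1. *)
Definition sp_rel : rel (seq X) := fun x y =>
  `[< exists N, [/\ (size x <= N)%N, (size y <= N)%N &
                    perm_eq (padded N x) (padded N y)] >].

Lemma paddedE N x : (size x <= N)%N -> padded N x = x ++ nseq (N - size x) e.
Proof.
move=> xN; apply: (@eq_from_nth _ e).
  by rewrite size_mkseq size_cat size_nseq subnKC.
move=> i; rewrite size_mkseq => iN; rewrite nth_mkseq// nth_cat nth_nseq.
case: ltnP => // xi; rewrite nth_default//; case: ifP => //.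
Qed.

Lemma padded_perm N N' x y : (size x <= N)%N -> (size y <= N)%N ->
  (N <= N')%N -> perm_eq (padded N x) (padded N y) ->
  perm_eq (padded N' x) (padded N' y).
Proof.
move=> xN yN NN' p.
have E z : (size z <= N)%N -> padded N' z = padded N z ++ nseq (N' - N) e.
  move=> zN; rewrite !paddedE// ?(leq_trans zN)// -catA -nseqD.
  by congr (_ ++ nseq _ _); lia.
by rewrite !E// perm_cat2r.
Qed.

Lemma sp_rel_refl : reflexive sp_rel.
Proof. by move=> x; apply/asboolP; exists (size x). Qed.

Lemma sp_rel_sym : symmetric sp_rel.
Proof.
by move=> x y; apply/asboolP/asboolP => -[N [? ? p]];
  exists N; split=> //; rewrite perm_sym.
Qed.

Lemma sp_rel_trans : transitive sp_rel.
Proof.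
move=> y x z /asboolP[N [xN yN p]] /asboolP[N' [yN' zN' p']].
have ? := leq_maxl N N'; have ? := leq_maxr N N'.
apply/asboolP; exists (maxn N N'); split.
- exact: (leq_trans xN).
- exact: (leq_trans zN').
- by apply: perm_trans (padded_perm _ _ _ p) (padded_perm _ _ _ p').
Qed.

Canonical sp_equiv := EquivRel sp_rel sp_rel_refl sp_rel_sym sp_rel_trans.

Definition fin_multiset := {eq_quot sp_rel}.

HB.instance Definition _ := Choice.on fin_multiset.
HB.instance Definition _ := EqQuotient.on fin_multiset.

Definition matching_cost (N : nat) x y (s : 'S_N) : R :=
  \sum_(i < N) mdist (nth e x i) (nth e y (s i)).

Definition min_cost (N : nat) x y : R :=
  \big[Num.min/matching_cost x y (1%g : 'S_N)]_(s : 'S_N) matching_cost x y s.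

Definition matching_dist x y : R :=
  inf [set min_cost N x y | N in [set N | (size x + size y <= N)%N]].

Lemma matching_cost_ge0 N x y (s : 'S_N) : 0 <= matching_cost x y s.
Proof. by apply: sumr_ge0 => i _; exact: mdist_ge0. Qed.

Lemma min_cost_le N x y (s : 'S_N) : min_cost N x y <= matching_cost x y s.
Proof. exact: bigmin_le_cond. Qed.

Lemma min_cost_attained N x y :
  exists s : 'S_N, min_cost N x y = matching_cost x y s.
Proof.
rewrite /min_cost; elim/big_ind: _ => [|a b [s ->] [t ->]|s _].
- by exists 1%g.
- by case: (leP (matching_cost x y s) (matching_cost x y t)) => _;
    [exists s|exists t].
- by exists s.
Qed.

Let costs x y := [set min_cost N x y | N in [set N | (size x + size y <= N)%N]].

Let costs_lb x y : lbound (costs x y) 0.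
Proof.
move=> _ [N _ <-]; have [s ->] := min_cost_attained N x y.
exact: matching_cost_ge0.
Qed.

Let costs_neq0 x y : costs x y !=set0.
Proof. by exists (min_cost (size x + size y) x y); exists (size x + size y)%N => /=. Qed.

Lemma matching_dist_ge0 x y : 0 <= matching_dist x y.
Proof. exact: lb_le_inf (@costs_neq0 _ _) (@costs_lb _ _). Qed.

Lemma matching_dist_le N x y (s : 'S_N) : (size x + size y <= N)%N ->
  matching_dist x y <= matching_cost x y s.
Proof.
move=> xyN; apply: le_trans (min_cost_le x y s).
by apply: ge_inf; [exists 0; exact: costs_lb|exists N].
Qed.

Lemma matching_dist_lt x y (eps : R) : 0 < eps ->
  exists N (s : 'S_N), (size x + size y <= N)%N /\
    matching_cost x y s < matching_dist x y + eps.
Proof.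
move=> e0; have [] := @inf_adherent _ (costs x y) _ e0.
  by split; [exact: costs_neq0|exists 0; exact: costs_lb].
move=> _ [N xyN <-]; have [s ->] := min_cost_attained N x y => lte.
by exists N, s.
Qed.

Lemma matching_cost_widen N N' x y (s : 'S_N) :
  (size x <= N)%N -> (size y <= N)%N -> (N <= N')%N ->
  exists s' : 'S_N', matching_cost x y s' = matching_cost x y s.
Proof.
move=> xN yN /subnKC <-; elim: (N' - N)%N => [|k [s' IH]].
  by rewrite addn0; exists s.
rewrite addnS; exists (lift_perm ord_max ord_max s').
rewrite -IH /matching_cost big_ord_recr/= lift_perm_id !nth_default ?mdistxx/=; last 2 first.
- by rewrite (leq_trans yN)// leq_addr.
- by rewrite (leq_trans xN)// leq_addr.
rewrite addr0; apply: eq_bigr => i _.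
have -> : widen_ord (leqnSn (N + k)) i = lift ord_max i.
  by apply: val_inj; rewrite /= /bump leqNgt ltn_ord.
by rewrite lift_perm_lift lift_max.
Qed.

Lemma matching_dist_triangle y x z :
  matching_dist x z <= matching_dist x y + matching_dist y z.
Proof.
apply/ler_addgt0Pr => eps e0; have e20 : 0 < eps / 2 by rewrite divr_gt0.
have [N1 [s1 [l1 h1]]] := matching_dist_lt x y e20.
have [N2 [s2 [l2 h2]]] := matching_dist_lt y z e20.
pose N := (N1 + N2)%N.
have [||| t1 t1E] := @matching_cost_widen _ N x y s1; [lia..|].
have [||| t2 t2E] := @matching_cost_widen _ N y z s2; [lia..|].
have : matching_dist x z <= matching_cost x z (t1 * t2)%g.
  by apply: matching_dist_le; lia.
have : matching_cost x z (t1 * t2)%g <=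
    matching_cost x y t1 + matching_cost y z t2.
  rewrite [X in _ + X](reindex_inj (@perm_inj _ t1))/= -big_split/=.
  by apply: ler_sum => i _; rewrite permM; exact: metric_triangle.
rewrite t1E t2E; lra.
Qed.

Lemma matching_dist_sym x y : matching_dist x y = matching_dist y x.
Proof.
wlog suff: x y / matching_dist x y <= matching_dist y x.
  by move=> H; apply/eqP; rewrite eq_le !H.
apply/ler_addgt0Pr => eps e0.
have [N [s [l h]]] := matching_dist_lt y x e0.
apply: le_trans (ltW h); rewrite addnC in l.
apply: le_trans (@matching_dist_le _ x y s^-1%g l) _.
rewrite /matching_cost (reindex_inj (@perm_inj _ s))/=.
by apply: ler_sum => i _; rewrite permK metric_sym.
Qed.

Lemma sp_rel_matching_dist0 x y : sp_rel x y -> matching_dist x y = 0.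
Proof.
move=> /asboolP[N [xN yN p]].
have := @padded_perm N (N + N) x y xN yN (leq_addr _ _) p.
have -> : padded (N + N) y = [tuple nth e y i | i < N + N].
  by rewrite /padded /mkseq -val_enum_ord -map_comp.
move=> /tuple_permP[s sE]; apply/eqP; rewrite eq_le matching_dist_ge0 andbT.
have /(@matching_dist_le _ _ _ s) : (size x + size y <= N + N)%N by lia.
move=> /le_trans; apply; rewrite /matching_cost big1// => i _.
have -> : nth e x i = nth e (padded (N + N) x) i by rewrite nth_mkseq.
by rewrite sE -tnth_nth !tnth_mktuple mdistxx.
Qed.

Let dist_gap (s : seq (X * X)) : exists2 eps : R, 0 < eps &
  forall p, p \in s -> p.1 != p.2 -> eps <= mdist p.1 p.2.
Proof.
elim: s => [|p s [eps e0 IH]]; first by exists 1.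
have [pp|pp] := eqVneq p.1 p.2.
  exists eps => // q; rewrite inE => /orP[/eqP ->|qs]; last exact: IH.
  by rewrite pp eqxx.
exists (Num.min eps (mdist p.1 p.2)).
  by rewrite lt_min e0 mdist_gt0.
move=> q; rewrite inE => /orP[/eqP -> _|qs qq]; rewrite ge_min ?lexx ?orbT//.
by rewrite IH.
Qed.

Lemma matching_dist0_sp_rel x y : matching_dist x y = 0 -> sp_rel x y.
Proof.
move=> xy0.
have [eps e0 gap] := dist_gap [seq (a, b) | a <- e :: x, b <- e :: y].
have [N [s []]] := matching_dist_lt x y e0.
rewrite xy0 add0r => l h; apply/asboolP; exists N; split; [lia..|].
have -> : padded N y = [tuple nth e y i | i < N].
  by rewrite /padded /mkseq -val_enum_ord -map_comp.
apply/tuple_permP; exists s.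
rewrite /padded /mkseq -val_enum_ord -map_comp; apply: eq_map => i /=.
rewrite tnth_mktuple; apply/eqP; apply: contraLR h => ne; rewrite -leNgt.
rewrite /matching_cost (bigD1 i)//=.
have mem w j : nth e w j \in e :: w.
  rewrite inE; have [jw|jw] := ltnP j (size w); first by rewrite mem_nth ?orbT.
  by rewrite nth_default// eqxx.
have := gap (nth e x i, nth e y (s i)).
rewrite allpairs_f// => /(_ isT ne) /= h.
by rewrite (le_trans h)// lerDl sumr_ge0// => *; exact: mdist_ge0.
Qed.

Definition fin_mdist (p q : fin_multiset) : R :=
  matching_dist (repr p) (repr q).

Lemma fin_mdistxx p : fin_mdist p p = 0.
Proof. exact/sp_rel_matching_dist0/sp_rel_refl. Qed.

Lemma fin_mdist_eq0 p q : fin_mdist p q = 0 -> p = q.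
Proof.
move=> pq; rewrite -[p]reprK -[q]reprK.
exact/(@eqmodP _ sp_equiv)/matching_dist0_sp_rel.
Qed.

Lemma fin_mdist_sym p q : fin_mdist p q = fin_mdist q p.
Proof. exact: matching_dist_sym. Qed.

Lemma fin_mdist_triangle q p r : fin_mdist p r <= fin_mdist p q + fin_mdist q r.
Proof. exact: matching_dist_triangle. Qed.

HB.instance Definition _ := isMetric.Build R fin_multiset
  fin_mdistxx fin_mdist_eq0 fin_mdist_sym fin_mdist_triangle.

Lemma sp_rel_repr x : sp_rel (repr (\pi_fin_multiset x)) x.
Proof. by apply/(@eqmodP _ sp_equiv); rewrite reprK. Qed.

Lemma mdist_fin_multiset x y :
  mdist (\pi_fin_multiset x) (\pi_fin_multiset y) = matching_dist x y.
Proof.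
rewrite /mdist/= /fin_mdist.
set x' := repr _; set y' := repr _.
have xx' : matching_dist x' x = 0 by apply: sp_rel_matching_dist0; exact: sp_rel_repr.
have yy' : matching_dist y' y = 0 by apply: sp_rel_matching_dist0; exact: sp_rel_repr.
have := matching_dist_triangle x x' y'; have := matching_dist_triangle y x y'.
have := matching_dist_triangle x' x y; have := matching_dist_triangle y' x' y.
by rewrite (matching_dist_sym x x') (matching_dist_sym y y') xx' yy'; lra.
Qed.

End finite_multisets.

Section l1_multisets.
Context {R : realType} {X : metricType R} (e : X).

Definition l1_seq : set (nat -> X) :=
  [set x | (\sum_(0 <= i <oo) (mdist (x i) e)%:E < +oo)%E].

Definition series_cost (x y : nat -> X) (s : nat -> nat) : \bar R :=
  (\sum_(0 <= i <oo) (mdist (x i) (y (s i)))%:E)%E.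

(* The infimum is taken in the extended reals, and is finite on [l1_seq]
   ([l1_edist_fin_num]). *)
Definition l1_edist (x y : nat -> X) : \bar R :=
  ereal_inf [set series_cost x y s | s in [set s : nat -> nat | bijective s]].

Definition l1_dist (x y : l1_seq) : R := fine (l1_edist (val x) (val y)).

Lemma series_cost_ge0 x y s : (0 <= series_cost x y s)%E.
Proof. by apply: nneseries_ge0 => i _ _; rewrite lee_fin mdist_ge0. Qed.

Lemma l1_edist_ge0 x y : (0 <= l1_edist x y)%E.
Proof. by apply: le_ereal_inf_tmp => _ [s _ <-]; exact: series_cost_ge0. Qed.

Lemma l1_edist_le x y s : bijective s -> (l1_edist x y <= series_cost x y s)%E.
Proof. by move=> sb; apply: ereal_inf_lbound; exists s. Qed.

Lemma series_reindex (f : nat -> R) s : (forall i, 0 <= f i) -> bijective s ->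
  (\sum_(0 <= i <oo) (f (s i))%:E = \sum_(0 <= i <oo) (f i)%:E)%E.
Proof.
move=> f0 sb; rewrite !nneseries_esumT => [|n|n]; rewrite ?lee_fin//.
rewrite (@reindex_esum R nat nat setT setT s (fun i => (f i)%:E))//.
by rewrite setTT_bijective.
Qed.

Lemma l1_edist_fin_num (x y : l1_seq) : l1_edist (val x) (val y) \is a fin_num.
Proof.
rewrite ge0_fin_numE ?l1_edist_ge0//.
apply: (le_lt_trans (@l1_edist_le _ _ id _)); first by exists id.
have : (series_cost (val x) (val y) id <= \sum_(0 <= i <oo) (mdist (val x i) e)%:E
    + \sum_(0 <= i <oo) (mdist (val y i) e)%:E)%E.
  rewrite -nneseriesD => [|i _ _|i _ _]; rewrite ?lee_fin ?mdist_ge0//.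
  apply: lee_nneseries => [i _ _|i _]; first by rewrite lee_fin mdist_ge0.
  by rewrite -EFinD lee_fin (metric_sym (val y i)); exact: metric_triangle.
move=> /le_lt_trans; apply; apply: lte_add_pinfty; [exact: (set_valP x)|exact: (set_valP y)].
Qed.

Lemma l1_edist_triangle y x z :
  (l1_edist x z <= l1_edist x y + l1_edist y z)%E.
Proof.
have [yz|yz] := boolP (l1_edist y z \is a fin_num); last first.
  have -> : l1_edist y z = +oo%E.
    apply/eqP; move: yz; rewrite ge0_fin_numE ?l1_edist_ge0// -leNgt.
    by rewrite leye_eq.
  by rewrite addey ?leey// gt_eqF// (lt_le_trans _ (l1_edist_ge0 _ _)) ?ltNye.
rewrite -leeBlDr//; apply: le_ereal_inf_tmp => _ [s sb <-]; rewrite leeBlDr//.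
have [xy|xy] := eqVneq (series_cost x y s) +oo%E.
  by rewrite xy addye ?leey// gt_eqF// (lt_le_trans _ (l1_edist_ge0 _ _)) ?ltNye.
have xyf : series_cost x y s \is a fin_num.
  by rewrite ge0_fin_numE ?series_cost_ge0// ltey.
rewrite -leeBlDl//; apply: le_ereal_inf_tmp => _ [t tb <-]; rewrite leeBlDl//.
apply: (le_trans (@l1_edist_le _ _ (t \o s) _)); first exact: bij_comp.
rewrite [X in (_ <= _ + X)%E]/series_cost.
rewrite -(series_reindex (f := fun i => mdist (y i) (z (t i)))
            (fun i => mdist_ge0 _ _) sb).
rewrite -nneseriesD => [|i _ _|i _ _]; rewrite ?lee_fin ?mdist_ge0//.
apply: lee_nneseries => [i _ _|i _]; first by rewrite lee_fin mdist_ge0.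
by rewrite -EFinD lee_fin; exact: metric_triangle.
Qed.

Lemma l1_edist_sym x y : l1_edist x y = l1_edist y x.
Proof.
wlog suff: x y / (l1_edist x y <= l1_edist y x)%E.
  by move=> H; apply/eqP; rewrite eq_le !H.
apply: le_ereal_inf_tmp => _ [s [t st ts] <-].
have tb : bijective t by exists s.
apply: (le_trans (l1_edist_le _ _ tb)).
rewrite /series_cost.
rewrite -(series_reindex (f := fun i => mdist (y i) (x (s i))) (fun i => mdist_ge0 _ _) tb).
apply: lee_nneseries => [i _ _|i _]; first by rewrite lee_fin mdist_ge0.
by rewrite lee_fin ts metric_sym.
Qed.

Lemma l1_distxx x : l1_dist x x = 0.
Proof.
rewrite /l1_dist [l1_edist _ _](_ : _ = 0%E)//; apply/eqP.
rewrite eq_le l1_edist_ge0 andbT.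
apply: (le_trans (@l1_edist_le _ _ id _)); first by exists id.
by rewrite /series_cost eseries0// => i _ _; rewrite mdistxx.
Qed.

Lemma l1_dist_sym x y : l1_dist x y = l1_dist y x.
Proof. by rewrite /l1_dist l1_edist_sym. Qed.

Lemma l1_dist_triangle y x z : l1_dist x z <= l1_dist x y + l1_dist y z.
Proof.
rewrite -lee_fin EFinD !fineK ?l1_edist_fin_num//.
exact: l1_edist_triangle.
Qed.

Definition l1_pseudometric : pseudometric R l1_seq :=
  Pseudometric l1_distxx l1_dist_sym l1_dist_triangle.

Definition l1_multiset := metric_quotient l1_pseudometric.

HB.instance Definition _ := Metric.on l1_multiset.
HB.instance Definition _ := EqQuotient.on l1_multiset.

Lemma nth_l1_seq (x : seq X) : l1_seq (nth e x).
Proof.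
rewrite /l1_seq/= (@nneseries_split _ _ 0%N (size x)) => [|k _].
  rewrite eseries0 => [|i xi _].
    by rewrite adde0 sumEFin ltry.
  by rewrite nth_default// mdistxx.
by rewrite lee_fin mdist_ge0.
Qed.

Definition list_to_l1 (x : seq X) : l1_multiset :=
  \pi_l1_multiset (SigSub (mem_set (nth_l1_seq x))).

Definition fin_to_l1 (p : fin_multiset e) : l1_multiset := list_to_l1 (repr p).

Definition perm_nat N (s : 'S_N) (i : nat) : nat :=
  if insub i is Some j then val (s j) else i.

Lemma perm_natE N (s : 'S_N) (i : 'I_N) : perm_nat s i = s i.
Proof. by rewrite /perm_nat valK. Qed.

Lemma perm_nat_id N (s : 'S_N) i : (N <= i)%N -> perm_nat s i = i.
Proof. by move=> Ni; rewrite /perm_nat insubF// ltnNge Ni. Qed.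

Lemma perm_natK N (s : 'S_N) : cancel (perm_nat s) (perm_nat s^-1%g).
Proof.
move=> i; have [iN|Ni] := ltnP i N; last by rewrite !perm_nat_id.
by rewrite (perm_natE s (Ordinal iN)) perm_natE permK.
Qed.

Lemma perm_nat_bij N (s : 'S_N) : bijective (perm_nat s).
Proof.
exists (perm_nat s^-1%g); first exact: perm_natK.
by move=> i; rewrite -{1}(invgK s) perm_natK.
Qed.

Lemma series_cost_perm_nat N (x y : seq X) (s : 'S_N) :
  (size x <= N)%N -> (size y <= N)%N ->
  series_cost (nth e x) (nth e y) (perm_nat s) = (matching_cost e x y s)%:E.
Proof.
move=> xN yN; rewrite /series_cost (@nneseries_split _ _ 0%N N) => [|k _].
  rewrite eseries0 => [|i Ni _]; last first.
    rewrite perm_nat_id// !nth_default ?mdistxx//; exact: leq_trans Ni.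
  rewrite adde0 sumEFin add0n big_mkord; congr EFin.
  by apply: eq_bigr => i _; rewrite perm_natE.
by rewrite lee_fin mdist_ge0.
Qed.

Lemma list_to_l1_sp_rel (x y : seq X) :
  sp_rel e x y -> list_to_l1 x = list_to_l1 y.
Proof.
move=> /sp_rel_matching_dist0 xy0.
apply/(@eqmodP _ (dist0_equiv l1_pseudometric)); rewrite /= /dist0 /= /l1_dist /=.
rewrite -eqe fineK; last first.
  exact: (l1_edist_fin_num (SigSub (mem_set (nth_l1_seq x)))
                           (SigSub (mem_set (nth_l1_seq y)))).
rewrite eq_le l1_edist_ge0 andbT; apply/lee_addgt0Pr => eps e0; rewrite add0e.
have [N [s [l]]] := matching_dist_lt e x y e0; rewrite xy0 add0r => h.
apply: (le_trans (l1_edist_le _ _ (perm_nat_bij s))).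
by rewrite series_cost_perm_nat ?lee_fin ?ltW//; lia.
Qed.

Lemma fin_to_l1E (x : seq X) :
  fin_to_l1 (\pi_(fin_multiset e) x) = list_to_l1 x.
Proof. exact/list_to_l1_sp_rel/sp_rel_repr. Qed.

Lemma mdist_l1_multiset (x y : l1_seq) :
  mdist (\pi_l1_multiset x) (\pi_l1_multiset y) = fine (l1_edist (val x) (val y)).
Proof. exact: mdist_pi. Qed.

End l1_multisets.

(* Main.v *)
Require Import Defs.
From mathcomp Require Import all_boot all_order all_algebra.
From mathcomp Require Import all_fingroup generic_quotient.
From mathcomp Require Import all_classical all_reals all_analysis.
From mathcomp Require Import zify lra.

Set Implicit Arguments.
Unset Strict Implicit.
Unset Printing Implicit Defensive.

Import Order.TTheory GRing.Theory Num.Theory.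
Import numFieldNormedType.Exports.
Import metricType_numDomainType.

Local Open Scope classical_set_scope.
Local Open Scope quotient_scope.
Local Open Scope ring_scope.

(** The three claims reduce to three facts about the canonical map from finite
multisets to l1-multisets: it preserves distances, its image is dense, and its
target is complete. Any such map extends to an isometry of the completion onto
its target ([completion_of_dense_embedding]), the extension of a Cauchy
sequence of finite multisets being the limit of its images.

Distances are preserved ([fin_to_l1_isometry]) because matching two finite
lists by a bijection of nat is never cheaper than by a finite permutation. Only
finitely many indices, those matched to or from an actual list entry, have
anything but the basepoint on either side; the bijection restricted to them is a
partial injection of a large enough ['I_N], which extends to a permutation, and
the extension pairs basepoints with basepoints at the remaining indices
([matching_dist_le_series_cost]).

The image is dense ([fin_to_l1_dense]) because truncating a summable sequence
moves it by at most the tail of its series.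

The target is complete ([l1_multiset_complete]) because it is enough to treat
sequences with consecutive distances below [2^-k] ([complete_of_fast_cvg]). For
such a sequence, choose nearly optimal bijections between consecutive terms and
compose them, so that all terms become enumerated compatibly: the k-th and
(k+1)-th enumerations are then at l1-distance below [2^-k] for the identity
matching. Each coordinate is Cauchy in [X], hence converges, and the bounds on
finite partial sums pass to the coordinatewise limit ([fast_l1_limit]). *)

(** * Fast Cauchy sequences in metric spaces *)

Section metric_sequences.
Context {R : realType}.

Lemma half_expr_gt0 k : 0 < 2^-1 ^+ k :> R.
Proof. by rewrite exprn_gt0// invr_gt0. Qed.

Lemma near_half_expr_lt (eps : R) : 0 < eps ->
  \forall k \near \oo, 2^-1 ^+ k < eps.
Proof.
move=> e0; have := near_infty_natSinv_expn_lt (PosNum e0).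
by apply: filterS => k; rewrite div1r exprVn.
Qed.

(** [D] is only required to behave like a pseudometric evaluated along a
sequence, so that the bound serves both distances in a space and partial sums of
such distances. The factor 2 is the sum of the geometric series; the inductive
proof needs the sharper bound with the remainder [2 * 2^-l] subtracted. *)
Lemma geometric_chain (D : nat -> nat -> R) :
  (forall k, D k k = 0) -> (forall k l m, D k m <= D k l + D l m) ->
  (forall k, D k k.+1 < 2^-1 ^+ k) ->
  forall k l, (k <= l)%N -> D k l <= 2 * 2^-1 ^+ k.
Proof.
move=> D0 Dtri Dstep k l /subnKC <-; set m := (l - k)%N.
suff : D k (k + m)%N <= 2 * 2^-1 ^+ k - 2 * 2^-1 ^+ (k + m).
  by have := half_expr_gt0 (k + m); lra.
elim: m => [|m IH]; first by rewrite addn0 D0 subrr.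
have := Dtri k (k + m)%N (k + m).+1; have := Dstep (k + m)%N.
by rewrite addnS exprS; lra.
Qed.

Lemma mdist_cvg (M : metricType R) (u v : nat -> M) (a b : M) :
  u @ \oo --> a -> v @ \oo --> b ->
  mdist (u n) (v n) @[n --> \oo] --> mdist a b.
Proof.
move=> /cvgrPdist_lt ua /cvgrPdist_lt vb.
apply/pseudometric_normed_Zmodule.cvgrPdist_lt => eps e0.
have e20 : 0 < eps / 2 by rewrite divr_gt0.
near=> n.
have un : mdist a (u n) < eps / 2 by near: n; exact: ua.
have vn : mdist b (v n) < eps / 2 by near: n; exact: vb.
have T1 := metric_triangle a (u n) b.
have T2 := metric_triangle (u n) (v n) b.
have T3 := metric_triangle (u n) a (v n).
have T4 := metric_triangle a b (v n).
rewrite (metric_sym (v n) b) in T2; rewrite (metric_sym (u n) a) in T3.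
rewrite ltr_norml; apply/andP; split; lra.
Unshelve. all: by end_near. Qed.

Lemma complete_fast_cvg (M : metricType R) (u : nat -> M) : complete M ->
  (forall k, mdist (u k) (u k.+1) < 2^-1 ^+ k) -> exists l : M, u @ \oo --> l.
Proof.
move=> cM ustep; apply: cM; apply/cauchy_exP => eps e0.
have e20 : 0 < eps / 2 by rewrite divr_gt0.
have [k _ /(_ k (leqnn k)) /= hk] := near_half_expr_lt e20.
exists (u k); exists k => // l /= kl; rewrite ballEmdist/=.
have /(_ k l kl) := @geometric_chain (fun k l => mdist (u k) (u l))
  (fun k => mdistxx _) (fun k l m => metric_triangle _ _ _) ustep.
by move=> /le_lt_trans; apply; lra.
Qed.

(** A Cauchy filter gives points [u k] whose ball of radius [2^-(k+1)] belongs to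
the filter. Two consecutive balls meet, so the sequence is fast, and the filter
converges wherever the sequence does. *)
Lemma complete_of_fast_cvg (M : metricType R) :
  (forall u : nat -> M, (forall k, mdist (u k) (u k.+1) < 2^-1 ^+ k) ->
    exists l : M, u @ \oo --> l) -> complete M.
Proof.
move=> fastM F PF /cauchyP cF.
have /choice[u Fu] k : exists x, F (ball x (2^-1 ^+ k.+1)).
  by apply: cF; exact: half_expr_gt0.
have [k|l ul] := fastM u.
  have [x []] := filter_ex (filterI (Fu k) (Fu k.+1)).
  rewrite !ballEmdist/= => h1 h2; have := metric_triangle (u k) x (u k.+1).
  rewrite (metric_sym x); move: h1 h2 (half_expr_gt0 k).
  rewrite !exprS; lra.
exists l; apply/fcvgrPdist_lt => eps e0.
have e20 : 0 < eps / 2 by rewrite divr_gt0.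
have : \forall k \near \oo, mdist l (u k) < eps / 2 /\ 2^-1 ^+ k < eps / 2.
  by apply: filterI; [exact: cvgr_dist_lt ul _ e20|exact: near_half_expr_lt].
case/filter_ex => k [lk hk].
apply: filterS (Fu k) => x; rewrite ballEmdist/= exprS => ukx.
have := metric_triangle l (u k) x; have := half_expr_gt0 k; lra.
Qed.

End metric_sequences.

(** * Completions and dense embeddings *)

Section dense_embeddings.
Context {R : realType} (M N : metricType R) (f : M -> N).
Hypotheses (f_isom : distance_preserving f) (f_dense : dense (range f)).
Hypothesis N_complete : complete N.

Lemma approx_by_image (y : N) (eps : R) : 0 < eps ->
  exists x : M, mdist y (f x) < eps.
Proof.
move=> e0; have [] := @f_dense (ball y eps)^°.
- by exists y; exact: nbhsx_ballx.
- exact: open_interior.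
by move=> z [/interior_subset + [x _ xz]]; rewrite -xz ballEmdist; exists x.
Qed.

Lemma image_cauchy_cvg (u : nat -> M) : cauchy_seq u ->
  exists l : N, (f \o u) @ \oo --> l.
Proof.
move=> cu; apply: N_complete; apply/cauchy_exP => eps e0.
have [k Hk] := cauchy_seqP cu e0.
exists (f (u k)); exists k => // n /= kn.
by rewrite ballEmdist/= f_isom Hk.
Qed.

Lemma cvg_image_cauchy (u : nat -> M) (l : N) :
  (f \o u) @ \oo --> l -> cauchy_seq u.
Proof.
move=> /cvgr_dist_lt ul; apply/cauchy_exP => eps e0.
have e20 : 0 < eps / 2 by rewrite divr_gt0.
have [k _ Hk] := ul _ e20.
exists (u k); exists k => // n /= kn; rewrite ballEmdist/= -f_isom.
have := Hk k (leqnn k); have := Hk n kn => /=.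
have := metric_triangle (f (u k)) l (f (u n)); rewrite (metric_sym _ l); lra.
Qed.

(** [phi] sends a class to the limit of the images of its chosen
representative. Distances pass to limits, which makes [phi] distance preserving,
hence injective and insensitive to the representative ([phi_pi]). A point of [N]
is the limit of images of points of [M] by density, and these points form a
Cauchy sequence because [f] preserves distances. *)
Lemma completion_of_dense_embedding : exists phi : completion M -> N,
  [/\ distance_preserving phi, bijective phi &
      forall x : M, phi (to_completion x) = f x].
Proof.
have /choice[phi phiP] (p : completion M) :
    exists l : N, (f \o val (repr p)) @ \oo --> l.
  exact: image_cauchy_cvg (set_valP (repr p)).
have dist_lim (u v : @cauchy_seq R M) (a b : N) :
    (f \o val u) @ \oo --> a -> (f \o val v) @ \oo --> b ->
    mdist a b = cauchy_dist u v.
  move=> ua vb; apply/esym; apply: cvg_lim => //.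
  by under eq_fun do rewrite -f_isom; exact: mdist_cvg.
have phi_pi (u : @cauchy_seq R M) (l : N) : (f \o val u) @ \oo --> l ->
    phi (\pi_(completion M) u) = l.
  move=> ul; apply: mdist_positivity.
  rewrite (dist_lim _ _ _ _ (phiP _) ul).
  exact/eqP/(dist0_repr (cauchy_pseudometric M)).
have phi_isom : distance_preserving phi.
  by move=> p q; exact: dist_lim (phiP p) (phiP q).
exists phi; split => //; last first.
  by move=> x; apply: phi_pi; exact: (@cvg_cst N (f x)).
have /choice[psi psiP] y : exists p, phi p = y.
  have /choice[u uy] k := approx_by_image y (half_expr_gt0 k).
  have fuy : (f \o u) @ \oo --> y.
    apply/cvgrPdist_lt => eps e0; apply: filterS (near_half_expr_lt e0) => k.
    exact: lt_trans (uy k).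
  exists (\pi_(completion M) (SigSub (mem_set (cvg_image_cauchy fuy)))).
  exact: phi_pi.
exists psi => // p; apply: mdist_positivity.
by rewrite -phi_isom psiP mdistxx.
Qed.

End dense_embeddings.

(** * Finite multisets inside l1-multisets *)

Lemma dense_range_mdist (R : realType) (M : Type) (N : metricType R) (f : M -> N) :
  (forall (y : N) (eps : R), 0 < eps -> exists x, mdist y (f x) < eps) ->
  dense (range f).
Proof.
move=> fapprox O [y Oy] oO.
have /nbhs_ballP[eps /= e0 epsO] : nbhs y O by exact: open_nbhs_nbhs.
have [x yx] := fapprox y eps e0.
by exists (f x); split; [apply: epsO; rewrite ballEmdist|exists x].
Qed.

(** Induction on [r]: a permutation [s] that agrees with [f] on the tail is
corrected at the head [a] by swapping [s a] with [f a]. The swap leaves the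
values already prescribed alone, since [s] and [f] are injective. *)
Lemma perm_extending (T : finType) (r : seq T) (f : T -> T) :
  {in r &, injective f} -> exists s : {perm T}, {in r, s =1 f}.
Proof.
elim: r => [|a r IH] finj; first by exists 1%g.
have [i j ir jr|s sf] := IH; first by apply: finj; rewrite inE ?ir ?jr orbT.
exists (s * tperm (s a) (f a))%g => i ir; rewrite permM.
have [->|ia] := eqVneq i a; first by rewrite tpermL.
have ir' : i \in r by move: ir; rewrite inE (negPf ia).
rewrite -(sf i ir') tpermD//; last rewrite sf//.
  by rewrite (inj_eq perm_inj) eq_sym.
by apply: contraNneq ia => /finj ->; rewrite ?inE ?eqxx ?ir' ?orbT.
Qed.

Section finite_into_l1.
Context {R : realType} {X : metricType R} (e : X).

(** A finite permutation does at least as well as any bijection of nat: keep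
[s] on the indices where either list has an actual entry, and complete it
arbitrarily. Outside these indices the completed permutation pairs [e] with [e],
at no cost. *)
Lemma matching_dist_le_series_cost (x y : seq X) (s : nat -> nat) :
  bijective s ->
  ((matching_dist e x y)%:E <= series_cost (nth e x) (nth e y) s)%E.
Proof.
move=> [t st ts].
(* The two sums bound the images under [s] of the positions of [x] and the
   preimages of the positions of [y]. *)
pose N := (size x + size y + \sum_(i < size x) (s i).+1
                           + \sum_(j < size y) (t j).+1)%N.
have s_lt i : (i < size x)%N -> (s i < N)%N.
  by move=> ix; rewrite /N (bigD1 (Ordinal ix))//=; lia.
have t_lt j : (j < size y)%N -> (t j < N)%N.
  by move=> jy; rewrite /N (bigD1 (Ordinal jy))//=; lia.
have s_ltA (i : 'I_N) : (i < size x)%N || (s i < size y)%N -> (s i < N)%N.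
  by case/orP => [/s_lt//|]; rewrite /N; lia.
(* Off the indices of interest, where [s] may leave ['I_N], [f] is junk. *)
pose f (i : 'I_N) : 'I_N := insubd i (s i).
have fE (i : 'I_N) : (i < size x)%N || (s i < size y)%N -> f i = s i :> nat.
  by move=> iA; rewrite /f val_insubd s_ltA.
pose B := [seq i : 'I_N <- enum 'I_N | (i < size x)%N || (s i < size y)%N].
have memB (i : 'I_N) : (i \in B) = ((i < size x)%N || (s i < size y)%N).
  by rewrite mem_filter mem_enum andbT.
have [i j|p pf] := @perm_extending _ B f.
  rewrite !memB => iA jA fij; apply/val_inj/(can_inj st) => /=.
  by rewrite -fE// -fE// fij.
have xyN : (size x + size y <= N)%N by rewrite /N; lia.
apply: (@le_trans _ _ (matching_cost e x y p)%:E).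
  by rewrite lee_fin matching_dist_le.
apply: (@le_trans _ _
  (\sum_(0 <= i < N) (mdist (nth e x i) (nth e y (s i)))%:E)%E); last first.
  by apply: nneseries_lim_ge => i _ _; rewrite lee_fin mdist_ge0.
rewrite sumEFin lee_fin big_mkord; apply: ler_sum => i _.
have [iB|/negP iB] := boolP (i \in B).
  by rewrite pf// fE// -memB.
have xi : (size x <= i)%N by rewrite leqNgt; apply/negP => ix; apply: iB; rewrite memB ix.
(* If [p i] were a position of [y], then [p] would also send the [s]-preimage
   of that position there, so this preimage, which lies in [B], would be [i]. *)
have yi : (size y <= p i)%N.
  rewrite leqNgt; apply/negP => piy; apply: iB.
  have jB : Ordinal (t_lt _ piy) \in B by rewrite memB/= ts piy orbT.
  suff <- : Ordinal (t_lt _ piy) = i by [].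
  apply: (@perm_inj _ p); apply: val_inj.
  by rewrite /= pf// fE -?memB//= ts.
by rewrite (nth_default e xi) (nth_default e yi) mdistxx mdist_ge0.
Qed.

Lemma l1_edist_nth (x y : seq X) :
  l1_edist (nth e x) (nth e y) = (matching_dist e x y)%:E.
Proof.
apply/eqP; rewrite eq_le; apply/andP; split; last first.
  apply: le_ereal_inf_tmp => _ [s sb <-]; exact: matching_dist_le_series_cost.
apply/lee_addgt0Pr => eps e0.
have [N [s [l h]]] := matching_dist_lt e x y e0.
apply: (le_trans (l1_edist_le _ _ (perm_nat_bij s))).
by rewrite series_cost_perm_nat ?lee_fin ?ltW//; lia.
Qed.

Lemma fin_to_l1_isometry : distance_preserving (@fin_to_l1 R X e).
Proof. by move=> p q; rewrite mdist_l1_multiset/= l1_edist_nth. Qed.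

Lemma mdist_l1_le (x y : l1_seq e) (s : nat -> nat) (c : R) : bijective s ->
  (series_cost (val x) (val y) s <= c%:E)%E ->
  mdist (\pi_(l1_multiset e) x) (\pi_(l1_multiset e) y) <= c.
Proof.
move=> sb h; rewrite mdist_l1_multiset -lee_fin fineK ?l1_edist_fin_num//.
exact: le_trans (l1_edist_le _ _ sb) h.
Qed.

Lemma mdist_l1_lt (x y : l1_seq e) (c : R) :
  mdist (\pi_(l1_multiset e) x) (\pi_(l1_multiset e) y) < c ->
  exists2 s : nat -> nat, bijective s &
    (series_cost (val x) (val y) s < c%:E)%E.
Proof.
rewrite mdist_l1_multiset -lte_fin fineK ?l1_edist_fin_num// => h.
by have [_ [s sb <-] hs] := ereal_inf_lt h; exists s.
Qed.

Lemma fin_to_l1_dense : dense (range (@fin_to_l1 R X e)).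
Proof.
apply: dense_range_mdist => y eps e0; rewrite -[y]reprK.
set x := repr y.
have e20 : (0 < (eps / 2)%:E)%E by rewrite lte_fin divr_gt0.
have tail0 := nneseries_tail_cvg (set_valP x)
  (fun i _ => mdist_ge0 (val x i) e : (0 <= (mdist (val x i) e)%:E)%E).
have [N _ /(_ N (leqnn N)) /= tailN] := tail0 _ (open_ereal_lt' e20).
exists (\pi_(fin_multiset e) (mkseq (val x) N)); rewrite fin_to_l1E.
apply: (@le_lt_trans _ _ (eps / 2)); last lra.
apply: (@mdist_l1_le _ _ id); first by exists id.
apply: le_trans (ltW tailN).
rewrite /series_cost/= (@nneseries_split _ _ 0%N N) => [|k _]; last first.
  by rewrite lee_fin mdist_ge0.
rewrite big1_seq ?add0e => [|i]; last first.
  rewrite mem_index_iota => /andP[_ /andP[_ iN]].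
  by rewrite nth_mkseq// mdistxx.
rewrite add0n; apply: lee_nneseries => [i _ _|i _]; first by rewrite lee_fin mdist_ge0.
have [iN|Ni] := ltnP i N; last by rewrite nth_default ?size_mkseq.
by rewrite nth_mkseq// mdistxx lee_fin mdist_ge0.
Qed.

End finite_into_l1.

(** * Completeness of l1-multisets *)

Section l1_completeness.
Context {R : realType} {X : metricType R} (e : X).
Hypothesis X_complete : complete X.

(** Each partial sum of [mdist (z k i) (z l i)] is at most [2 * 2^-k] for all
[l >= k]; letting [l] grow first, and only then the length of the sum, bounds the
whole series against the coordinatewise limit [w]. *)
Lemma fast_l1_limit (z : nat -> nat -> X) :
  (forall k, (\sum_(0 <= i <oo) (mdist (z k i) (z k.+1 i))%:E
                < (2^-1 ^+ k)%:E)%E) ->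
  exists w : nat -> X, forall k,
    (\sum_(0 <= i <oo) (mdist (w i) (z k i))%:E <= (2 * 2^-1 ^+ k)%:E)%E.
Proof.
move=> zstep.
pose D n k l := \sum_(0 <= i < n) mdist (z k i) (z l i).
have Dstep n k : D n k k.+1 < 2^-1 ^+ k.
  rewrite -lte_fin -sumEFin; apply: le_lt_trans (zstep k).
  by apply: nneseries_lim_ge => i _ _; rewrite lee_fin mdist_ge0.
have Dle n k l : (k <= l)%N -> D n k l <= 2 * 2^-1 ^+ k.
  apply: geometric_chain => [{}k|{}k {}l m|{}k]; last exact: Dstep.
    by apply: big1 => i _; rewrite mdistxx.
  by rewrite -big_split; apply: ler_sum => i _; exact: metric_triangle.
have /choice[w zw] i : exists l : X, z ^~ i @ \oo --> l.
  apply: complete_fast_cvg => // k; apply: le_lt_trans (Dstep i.+1 k).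
  rewrite /D big_nat_recr//= lerDr sumr_ge0// => j _; exact: mdist_ge0.
exists w => k.
apply: lime_le.
  by apply: is_cvg_nneseries => i _ _; rewrite lee_fin mdist_ge0.
apply: nearW => n; rewrite sumEFin lee_fin.
under eq_bigr do rewrite metric_sym.
have Dcvg : D n k l @[l --> \oo] --> \sum_(0 <= i < n) mdist (z k i) (w i).
  apply: cvg_big => [|i _]; first exact: add_continuous.
  apply: mdist_cvg; first exact: cvg_cst.
  exact: zw.
apply: (cvgr_to_le Dcvg).
by exists k => // l /= kl; exact: Dle.
Qed.

(** Representatives of consecutive terms are only close after a reordering
[s k]. Reordering the [k]-th one by [t k], the composite of the previous [s j],
makes them close coordinate by coordinate. *)
Lemma l1_multiset_complete : complete (l1_multiset e).
Proof.
apply: complete_of_fast_cvg => u ustep.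
pose x k : l1_seq e := repr (u k).
have uE k : u k = \pi_(l1_multiset e) (x k) by rewrite reprK.
have /choice[s sP] k : exists s : nat -> nat, bijective s /\
    (series_cost (val (x k)) (val (x k.+1)) s < (2^-1 ^+ k)%:E)%E.
  have := ustep k; rewrite !uE => /mdist_l1_lt[s sb h]; by exists s.
pose t := fix t k : nat -> nat := if k is k'.+1 then s k' \o t k' else id.
have t_bij k : bijective (t k).
  elim: k => [|k IH] /=; first by exists id.
  by apply: bij_comp => //; have [] := sP k.
pose z k i := val (x k) (t k i).
have [k|w wP] := @fast_l1_limit z.
  have [_] := sP k; rewrite /series_cost.
  by rewrite -(series_reindex (f := fun i => mdist (val (x k) i) (val (x k.+1) (s k i)))
    (fun i => mdist_ge0 _ _) (t_bij k)).
(* Summability of the limit is inherited from the 0-th term. *)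
have w_l1 : l1_seq e w.
  apply: (@le_lt_trans _ _ ((\sum_(0 <= i <oo) (mdist (w i) (z 0%N i))%:E) +
      \sum_(0 <= i <oo) (mdist (z 0%N i) e)%:E)%E).
    rewrite -nneseriesD => [|i _ _|i _ _]; rewrite ?lee_fin ?mdist_ge0//.
    apply: lee_nneseries => [i _ _|i _]; first by rewrite lee_fin mdist_ge0.
    by rewrite -EFinD lee_fin metric_triangle.
  apply: lte_add_pinfty; last exact: (set_valP (x 0%N)).
  by apply: le_lt_trans (wP 0%N) _; exact: ltry.
exists (\pi_(l1_multiset e) (SigSub (mem_set w_l1))).
apply/cvgrPdist_lt => eps e0.
have e20 : 0 < eps / 2 by rewrite divr_gt0.
apply: filterS (near_half_expr_lt e20) => k hk.
apply: (@le_lt_trans _ _ (2 * 2^-1 ^+ k)); last lra.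
rewrite uE; apply: (mdist_l1_le (t_bij k)); exact: wP.
Qed.

End l1_completeness.

Theorem theorem4p10 (R : realType) (X : metricType R) (e : X)
    (complete_X : complete X) :
  [/\ exists phi : completion (fin_multiset e) -> l1_multiset e,
        [/\ distance_preserving phi, bijective phi &
            forall p : fin_multiset e, phi (to_completion p) = fin_to_l1 p],
      dense (range (@fin_to_l1 R X e)) &
      complete (l1_multiset e)].
Proof.
have dns := @fin_to_l1_dense R X e.
have cpl := @l1_multiset_complete R X e complete_X.
split => //.
exact: completion_of_dense_embedding (@fin_to_l1_isometry R X e) dns cpl.
Qed.
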